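(* Let $f_1,\dots,f_m:\mathbb{R}^n\to\mathbb{R}$ and $g_1,\dots,g_k:\mathbb{R}^n\to\mathbb{R}$ be smooth convex functions, let $I=\{1,\dots,m\}$, $K=\{1,\dots,k\}$, and let $X=\{x\in\mathbb{R}^n: g_j(x)\le 0 \text{ for all } j\in K\}$. Consider the convex vector optimization problem (CVOP) of minimizing $f(x)=(f_1(x),\dots,f_m(x))$ over $x\in X$, and let $x_0\in X$. (Necessity) If $x_0$ is a Pareto minimizer of CVOP and the strong Abadie type regularity condition is satisfied at $x_0$, then there exist $\lambda^*\in\mathbb{R}^m_+$ and $\mu^*\in\mathbb{R}^k_+$ such that $$\text{(a)}\quad \sum_{i\in I}\lambda_i^*\nabla f_i(x_0)+\sum_{j\in K}\mu_j^*\nabla g_j(x_0)=0,$$ $$\text{(b)}\quad \mu_j^*g_j(x_0)=0\ \text{ for all } j\in K,$$ $$\text{(c)}\quad \lambda_i^*>0\ \text{ for all } i\in I.$$ (Sufficiency) Conversely, if there exist $\lambda^*\in\mathbb{R}^m_+$ and $\mu^*\in\mathbb{R}^k_+$ satisfying (a), (b) and (c), then $x_0$ is a Pareto minimizer of CVOP.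
   Context: ''Smooth'' may be read as differentiable on $\mathbb{R}^n$ (a differentiable convex function on $\mathbb{R}^n$ is automatically continuously differentiable). $\mathbb{R}^m_+$ denotes the set of vectors in $\mathbb{R}^m$ with all components non-negative. Pareto minimizer: a point $x^*\in X$ is a Pareto minimizer of CVOP if there is no $x\in X$ with $f(x)-f(x^* )\in -\mathbb{R}^m_+\setminus\{0\}$; that is, there is no $x\in X$ with $f_i(x)\le f_i(x^* )$ for all $i\in I$ and $f_r(x)<f_r(x^* )$ for some $r\in I$. Tangent cone: for a set $S\subseteq\mathbb{R}^n$ and $x_0\in S$, $T_S(x_0)=\{d\in\mathbb{R}^n: \exists\ \{t_l\}\subseteq\mathbb{R}_+,\ \{y_l\}\subseteq S \text{ with } y_l\to x_0 \text{ and } t_l(y_l-x_0)\to d\}$. Strong Abadie type regularity condition: for $x_0\in X$ put $\hat X(x_0)=\{x\in X: f_i(x)\le f_i(x_0) \text{ for all } i\in I\}$, let $\mathcal{R}(x_0)=\{j\in K: g_j(x_0)=0\}$ be the set of active constraint indices, and let $$V(x_0)=\{h\in\mathbb{R}^n: f_i'(x_0,h)\le 0 \text{ for all } i\in I,\ g_j'(x_0,h)\le 0 \text{ for all } j\in\mathcal{R}(x_0)\},$$ where $\phi'(x_0,h)$ denotes the directional derivative of $\phi$ at $x_0$ in direction $h$ (equal to $\langle\nabla\phi(x_0),h\rangle$ for differentiable $\phi$). The problem CVOP satisfies the strong Abadie type regularity condition at $x_0$ if $T_{\hat X(x_0)}(x_0)=V(x_0)$. *)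

(* Defs.v *)
From mathcomp Require Import all_boot all_order all_algebra.
From mathcomp Require Import all_classical all_reals all_analysis.

Set Implicit Arguments.
Unset Strict Implicit.
Unset Printing Implicit Defensive.

Import Order.TTheory GRing.Theory Num.Theory.
Import numFieldNormedType.Exports.

Local Open Scope classical_set_scope.
Local Open Scope ring_scope.

(* The library norm on 'rV[R]_n is the sup norm; only the (norm-independent)
   topology it induces matters below. *)

Definition nonneg_orthant (R : realType) (m : nat) : set 'rV[R]_m :=
  [set v | forall i, 0 <= v ord0 i].

Definition gradient (R : realType) (n : nat) (phi : 'rV[R]_n -> R)
    (x : 'rV[R]_n) : 'rV[R]_n :=
  \row_j 'D_(delta_mx ord0 j) phi x.

Definition feasible_set (R : realType) (n k : nat)
    (g : 'I_k -> 'rV[R]_n -> R) : set 'rV[R]_n :=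
  [set x | forall j, g j x <= 0].

Definition pareto_minimizer (R : realType) (n m : nat) (X : set 'rV[R]_n)
    (f : 'I_m -> 'rV[R]_n -> R) (xs : 'rV[R]_n) : Prop :=
  X xs /\
  ~ (exists2 x, X x & (forall i, f i x <= f i xs) /\ (exists r, f r x < f r xs)).

Definition tangent_cone (R : realType) (n : nat) (S : set 'rV[R]_n)
    (x0 : 'rV[R]_n) : set 'rV[R]_n :=
  [set d | exists (t : nat -> R) (y : nat -> 'rV[R]_n),
    [/\ forall l, 0 <= t l,
        forall l, S (y l),
        y l @[l --> \oo] --> x0 &
        t l *: (y l - x0) @[l --> \oo] --> d]].

(* $\hat X(x_0)$ *)
Definition improving_set (R : realType) (n m : nat) (X : set 'rV[R]_n)
    (f : 'I_m -> 'rV[R]_n -> R) (x0 : 'rV[R]_n) : set 'rV[R]_n :=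
  [set x | X x /\ forall i, f i x <= f i x0].

Definition active_constraints (R : realType) (n k : nat)
    (g : 'I_k -> 'rV[R]_n -> R) (x0 : 'rV[R]_n) : set 'I_k :=
  [set j | g j x0 = 0].

(* $V(x_0)$; ['D_h phi x0] is the two-sided limit of the difference quotients,
   which agrees with the one-sided directional derivative of convex analysis
   whenever [phi] is differentiable at [x0]. *)
Definition linearized_cone (R : realType) (n m k : nat)
    (f : 'I_m -> 'rV[R]_n -> R) (g : 'I_k -> 'rV[R]_n -> R)
    (x0 : 'rV[R]_n) : set 'rV[R]_n :=
  [set h | (forall i, 'D_h (f i) x0 <= 0) /\
           (forall j, active_constraints g x0 j -> 'D_h (g j) x0 <= 0)].

Definition strong_abadie (R : realType) (n m k : nat)
    (f : 'I_m -> 'rV[R]_n -> R) (g : 'I_k -> 'rV[R]_n -> R)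
    (x0 : 'rV[R]_n) : Prop :=
  tangent_cone (improving_set (feasible_set g) f x0) x0 =
  linearized_cone f g x0.

Definition strong_kkt (R : realType) (n m k : nat)
    (f : 'I_m -> 'rV[R]_n -> R) (g : 'I_k -> 'rV[R]_n -> R)
    (x0 : 'rV[R]_n) (lambda : 'rV[R]_m) (mu : 'rV[R]_k) : Prop :=
  [/\ \sum_(i < m) lambda ord0 i *: gradient (f i) x0
        + \sum_(j < k) mu ord0 j *: gradient (g j) x0 = 0,
      forall j, mu ord0 j * g j x0 = 0 &
      forall i, 0 < lambda ord0 i].

(* Main.v *)
(** Necessity: at a Pareto minimizer the tangent cone of the improving set, and
    hence by regularity the whole linearized cone, contains only directions
    along which no objective decreases to first order.  So for each [r],
    Farkas' lemma writes [- gradient (f r) x0] as a nonnegative combination of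
    the gradients of all the objectives and of the active constraints; summing
    these identities over [r] gives each objective a weight of at least 1.
    Sufficiency: the gradient inequality of convex functions, weighted by the
    multipliers, contradicts the existence of a dominating feasible point. *)
Require Import Defs.
From mathcomp Require Import all_boot all_order all_algebra.
From mathcomp Require Import all_classical all_reals all_analysis.
From mathcomp Require Import lra.
Import Order.TTheory GRing.Theory Num.Theory.
Import numFieldNormedType.Exports.
Local Open Scope classical_set_scope.
Local Open Scope ring_scope.

(* Bartl's induction: if the last inequality [a x <= 0] cannot be dropped, pick
   a witness [z] violating the statement without it; then [a z > 0], and
   projecting along [z] onto the kernel of [a] eliminates [a]. *)
Lemma farkas (R : realFieldType) (n p : nat) (A : 'M[R]_(p, n)) (b : 'rV[R]_n) :
  (forall x : 'cV[R]_n,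
    (forall i, (A *m x) i ord0 <= 0) -> (b *m x) ord0 ord0 <= 0) ->
  exists2 c : 'rV[R]_p, (forall i, 0 <= c ord0 i) & b = c *m A.
Proof.
elim: p A b => [|p IHp] A b Ab.
  exists 0; first by move=> i; rewrite mxE.
  rewrite mul0mx; apply/rowP => j; rewrite mxE; apply/eqP.
  have bE s : (b *m (s *: (delta_mx j 0 : 'cV[R]_n))) ord0 ord0 = s * b ord0 j.
    by rewrite -scalemxAr -colE !mxE.
  have le0 s : s * b ord0 j <= 0 by rewrite -bE; apply: Ab => - [].
  by have := le0 1; have := le0 (-1); lra.
move: A Ab; rewrite -[p.+1]/(1 + p)%N => A.
rewrite -[A]vsubmxK; move: (usubmx A) (dsubmx A) => a B Ab.
have [Bb|/existsNP[z]] := pselect (forall x : 'cV[R]_n,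
    (forall i, (B *m x) i ord0 <= 0) -> (b *m x) ord0 ord0 <= 0).
  have [c c0 ->] := IHp _ _ Bb.
  exists (row_mx 0 c); last by rewrite mul_row_col mul0mx add0r.
  by move=> i; rewrite mxE; case: fintype.split => j; rewrite ?mxE.
rewrite not_implyE => -[Bz /negP]; rewrite -ltNge => bz0.
have az0 : 0 < (a *m z) ord0 ord0.
  rewrite ltNge; apply: contraTN bz0 => az; rewrite -leNgt; apply: Ab => i.
  by rewrite mul_col_mx mxE; case: fintype.split => j //; rewrite (ord1 j).
pose y := ((a *m z) ord0 ord0)^-1 *: z.
have ay : a *m y = 1%:M.
  rewrite -scalemxAr; apply/matrixP => i j; rewrite !ord1 mxE [RHS]mxE.
  by apply: mulVf; exact: lt0r_neq0.
have By i : (B *m y) i ord0 <= 0.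
  by rewrite -scalemxAr mxE mulr_ge0_le0// invr_ge0 ltW.
have by0 : 0 <= (b *m y) ord0 ord0.
  by rewrite -scalemxAr mxE; apply: mulr_ge0; rewrite ?invr_ge0 ltW.
have projE q (C : 'M[R]_(q, n)) (x : 'cV[R]_n) :
    (C - C *m y *m a) *m x = C *m (x - y *m (a *m x)).
  by rewrite mulmxBl mulmxBr !mulmxA.
have [x Bx|c c0 bE] := IHp (B - B *m y *m a) (b - b *m y *m a).
  rewrite projE; apply: Ab => i.
  rewrite mul_col_mx mxE; case: fintype.split => j; last by rewrite -projE.
  by rewrite mulmxBr (mulmxA a y) ay mul1mx subrr mxE.
(* Expanding [bE] and collecting the multiples of [a] gives its weight, which is nonnegative because
   [b *m y] is nonnegative while [c *m (B *m y)] is nonpositive. *)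
exists (row_mx (b *m y - c *m (B *m y)) c).
  move=> i; rewrite mxE; case: fintype.split => // j.
  rewrite (ord1 j) mxE addr_ge0//.
  rewrite mxE oppr_ge0 mxE sumr_le0// => l _.
  by rewrite mulr_ge0_le0.
rewrite mul_row_col mulmxBl; move/eqP: bE; rewrite subr_eq => /eqP {1}->.
by rewrite mulmxBr !mulmxA addrC addrA [RHS]addrAC -!addrA.
Qed.

Lemma mul_gradient (R : realType) (n : nat) (phi : 'rV[R]_n -> R)
    (x h : 'rV[R]_n) : differentiable phi x ->
  (gradient phi x *m h^T) ord0 ord0 = 'D_h phi x.
Proof.
move=> dphi; rewrite [in RHS](row_sum_delta h) deriveE// linear_sum mxE.
apply: eq_bigr => j _.
by rewrite linearZ !mxE deriveE// mulrC.
Qed.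

(** Convexity bounds the difference quotient by [phi y - phi x] only for steps [t] in (0, 1], so the
    two-sided limit is first replaced by the limit from the right. *)
Lemma convex_derive_le (R : realType) (n : nat) (phi : 'rV[R]_n -> R)
    (x y : 'rV[R]_n) :
  differentiable phi x -> convex_function [set: 'rV[R]_n] phi ->
  'D_(y - x) phi x <= phi y - phi x.
Proof.
move=> dphi cphi; have dv : derivable phi x (y - x) by exact: diff_derivable.
rewrite /derive cvg_at_rightE//; apply: limr_le.
  by apply/cvg_ex; eexists; apply: cvg_dnbhs_at_right; exact: dv.
near=> t.
have t0 : 0 < t by near: t; exact: nbhs_right_gt.
have t1 : t <= 1 by near: t; exact: nbhs_right_le.
have := cphi (Itv01 (ltW t0) t1) y x (in_setT _) (in_setT _).
rewrite convRE /conv/= /unstable.onem => phi_t.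
rewrite -[_ *: _]/(_ * _) ler_pdivrMl//=.
have -> : t *: (y - x) + x = t *: y + (1 - t) *: x.
  by rewrite scalerBr scalerBl scale1r addrAC addrA.
lra.
Unshelve. all: by end_near. Qed.

(** Since [phi (y l) - phi x] is nonnegative, the differential at [y l - x] is eventually at least
    [- e * |y l - x|]. Scaling by [t l] and passing to the limit gives [- e * |d|] as a lower bound
    at [d], for every positive [e]. *)
Lemma tangent_cone_derive_ge0 (R : realType) (n : nat) (phi : 'rV[R]_n -> R)
    (S : set 'rV[R]_n) (x d : 'rV[R]_n) :
  differentiable phi x -> (forall y, S y -> phi x <= phi y) ->
  tangent_cone S x d -> 0 <= 'D_d phi x.
Proof.
move=> dphi phi_min [t [y [t0 Sy yx tyd]]]; rewrite deriveE//.
have ge0 (e : R) : 0 < e -> 0 <= 'd phi x d + e * `|d|.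
  move=> e0.
  have cv : 'd phi x (t l *: (y l - x)) + e * `|t l *: (y l - x)|
      @[l --> \oo] --> 'd phi x d + e * `|d|.
    apply: cvgD; last by apply: cvgMr; exact: cvg_norm.
    by apply: continuous_cvg tyd; exact: diff_continuous.
  rewrite -(cvg_lim _ cv)//; apply: limr_ge.
    by apply/cvg_ex; eexists; exact: cv.
  have yx0 : y l - x @[l --> \oo] --> (0 : 'rV[R]_n).
    by rewrite -(subrr x); apply: cvgB => //; exact: cvg_cst.
  have /eqaddoP/(_ _ e0) small := diff_locally dphi.
  near=> l.
  have : `|(phi \o shift x - (cst (phi x) + 'd phi x)) (y l - x)|
      <= e * `|y l - x|.
    by near: l; exact: (yx0 _ small).
  rewrite !fctE/= subrK => rem.
  rewrite linearZ normrZ (ger0_norm (t0 l)) mulrCA -mulrDr mulr_ge0//.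
  have := ler_norm (phi (y l) - (phi x + 'd phi x (y l - x))).
  have := phi_min _ (Sy l).
  lra.
apply/ler_addgt0Pr => e e0.
(* The added 1 keeps the denominator positive when [d] is zero. *)
have d1 : 0 < `|d| + 1 by rewrite ltr_wpDl.
apply: (le_trans (ge0 (e / (`|d| + 1)) _)); first by rewrite divr_gt0.
rewrite lerD2l mulrAC ler_pdivrMr// ler_pM2l//; lra.
Unshelve. all: by end_near. Qed.

Lemma pareto_multipliers (R : realType) (n m k : nat)
    (f : 'I_m -> 'rV[R]_n -> R) (g : 'I_k -> 'rV[R]_n -> R) (x0 : 'rV[R]_n)
    (r : 'I_m) :
  (forall i, differentiable (f i) x0) -> (forall j, differentiable (g j) x0) ->
  pareto_minimizer (feasible_set g) f x0 -> strong_abadie f g x0 ->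
  exists lu : 'rV[R]_m * 'rV[R]_k,
    [/\ nonneg_orthant lu.1, nonneg_orthant lu.2,
        forall j, lu.2 ord0 j * g j x0 = 0 &
        - gradient (f r) x0 = \sum_(i < m) lu.1 ord0 i *: gradient (f i) x0
          + \sum_(j < k) lu.2 ord0 j *: gradient (g j) x0].
Proof.
move=> df dg [_ x0min] abadie.
pose F : 'M[R]_(m, n) := \matrix_(i < m) gradient (f i) x0.
(* Inactive constraints get a zero row: the index type stays ['I_k], and Farkas' lemma sees only the
   active gradients. *)
pose G : 'M[R]_(k, n) :=
  \matrix_(j < k) (if g j x0 == 0 then gradient (g j) x0 else 0).
have [h Ah|c c0 bE] := @farkas R n (m + k) (col_mx F G) (- gradient (f r) x0).
  have rowE q (C : 'M[R]_(q, n)) i :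
      (C *m h) i ord0 = (row i C *m h) ord0 ord0 by rewrite -row_mul [RHS]mxE.
  have hV : linearized_cone f g x0 h^T.
    split=> [i|j gj0].
      have := Ah (lshift k i).
      by rewrite mul_col_mx col_mxEu rowE rowK -mul_gradient// trmxK.
    have := Ah (rshift m j).
    by rewrite mul_col_mx col_mxEd rowE rowK gj0 eqxx -mul_gradient// trmxK.
  rewrite mulNmx mxE oppr_le0 -[h]trmxK mul_gradient//.
  (* Over the improving set [f r] is minimal at [x0]: a point with a smaller value would dominate
     [x0]. *)
  move: hV; rewrite -abadie; apply: tangent_cone_derive_ge0 => // y [Xy fy].
  rewrite leNgt; apply/negP => fr; apply: x0min.
  by exists y => //; split=> //; exists r.
(* Resetting the weights of inactive constraints to 0 yields complementary slackness and keeps the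
   combination, as their rows vanish. *)
exists (lsubmx c,
  \row_j (if g j x0 == 0 then c ord0 (rshift m j) else 0)); split.
- by move=> i; rewrite mxE.
- by move=> j; rewrite mxE; case: ifP.
- by move=> j; rewrite mxE; case: eqP => [->|_]; rewrite ?mulr0 ?mul0r.
- rewrite bE -{1}[c]hsubmxK mul_row_col; congr (_ + _).
    rewrite mulmx_sum_row; apply: eq_bigr => i _; by rewrite rowK.
  rewrite mulmx_sum_row; apply: eq_bigr => j _; rewrite rowK !mxE.
  by case: eqP => _; rewrite ?scaler0 ?scale0r.
Qed.

Theorem theorem2p5 (R : realType) (n m k : nat)
    (f : 'I_m -> 'rV[R]_n -> R) (g : 'I_k -> 'rV[R]_n -> R)
    (f_smooth : forall i (x : 'rV[R]_n), differentiable (f i) x)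
    (g_smooth : forall j (x : 'rV[R]_n), differentiable (g j) x)
    (f_convex : forall i, convex_function [set: 'rV[R]_n] (f i))
    (g_convex : forall j, convex_function [set: 'rV[R]_n] (g j))
    (x0 : 'rV[R]_n) (x0X : feasible_set g x0) :
  (pareto_minimizer (feasible_set g) f x0 -> strong_abadie f g x0 ->
   exists (lambda : 'rV[R]_m) (mu : 'rV[R]_k),
     [/\ nonneg_orthant lambda, nonneg_orthant mu &
         strong_kkt f g x0 lambda mu])
  /\
  ((exists (lambda : 'rV[R]_m) (mu : 'rV[R]_k),
     [/\ nonneg_orthant lambda, nonneg_orthant mu &
         strong_kkt f g x0 lambda mu]) ->
   pareto_minimizer (feasible_set g) f x0).
Proof.
split=> [x0min abadie|[lambda [mu [lambda0 mu0 [statio slack lambda_gt0]]]]].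
  have [lu luP] := choice (fun r => pareto_multipliers R n m k f g x0 r
    (f_smooth^~ x0) (g_smooth^~ x0) x0min abadie).
  have l0 i : 0 <= \sum_r (lu r).1 ord0 i.
    by apply: sumr_ge0 => r _; have [/(_ i)] := luP r.
  (* The 1 is the coefficient of [gradient (f i) x0] moved across the identity for [r = i]. *)
  exists (\row_i (1 + \sum_r (lu r).1 ord0 i)), (\row_j \sum_r (lu r).2 ord0 j).
  split; [| |split].
  - by move=> i; rewrite mxE addr_ge0.
  - by move=> j; rewrite mxE; apply: sumr_ge0 => r _; have [_ /(_ j)] := luP r.
  - have -> : \sum_(i < m) (\row_i (1 + \sum_r (lu r).1 ord0 i)) ord0 i
          *: gradient (f i) x0
        = \sum_r (gradient (f r) x0
            + \sum_(i < m) (lu r).1 ord0 i *: gradient (f i) x0).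
      rewrite big_split exchange_big -big_split; apply: eq_bigr => i _ /=.
      by rewrite mxE scalerDl scale1r scaler_suml.
    have -> : \sum_(j < k) (\row_j \sum_r (lu r).2 ord0 j) ord0 j
          *: gradient (g j) x0
        = \sum_r \sum_(j < k) (lu r).2 ord0 j *: gradient (g j) x0.
      rewrite exchange_big; apply: eq_bigr => j _ /=.
      by rewrite mxE scaler_suml.
    rewrite -big_split big1// => r _ /=.
    by have [_ _ _ fr] := luP r; rewrite -addrA -fr subrr.
  - move=> j; rewrite mxE mulr_suml big1// => r _.
    by have [_ _ ->] := luP r.
  - by move=> i; rewrite mxE ltr_pwDl.
split=> // -[x Xx [fle [r flt]]].
have Df i : lambda ord0 i * 'D_(x - x0) (f i) x0
    <= lambda ord0 i * (f i x - f i x0).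
  by rewrite ler_wpM2l// convex_derive_le.
(* By slackness the bound from the gradient inequality reduces to [mu ord0 j * g j x], nonpositive
   by feasibility. *)
have Dg j : mu ord0 j * 'D_(x - x0) (g j) x0 <= 0.
  apply: (@le_trans _ _ (mu ord0 j * (g j x - g j x0))).
    by rewrite ler_wpM2l// convex_derive_le.
  by rewrite mulrBr slack subr0 mulr_ge0_le0// Xx.
have : \sum_(i < m) lambda ord0 i * 'D_(x - x0) (f i) x0
    + \sum_(j < k) mu ord0 j * 'D_(x - x0) (g j) x0 = 0.
  have /(congr1 (fun v => (v *m (x - x0)^T) ord0 ord0)) := statio.
  rewrite mulmxDl mul0mx !mulmx_suml !mxE !summxE => sum0; rewrite -[RHS]sum0.
  by congr (_ + _); apply: eq_bigr => i _; rewrite -scalemxAl mxE mul_gradient.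
(* Stationarity paired with [x - x0] gives 0, yet every term is nonpositive and the one at [r] is
   negative. *)
apply/eqP; rewrite lt_eqF// -[ltRHS]addr0 ltr_leD//; last exact: sumr_le0.
rewrite (bigD1 r)//= -[ltRHS]addr0 ltr_leD//.
  by rewrite (le_lt_trans (Df r))// pmulr_rlt0// subr_lt0.
by apply: sumr_le0 => i _; rewrite (le_trans (Df i))// mulr_ge0_le0// subr_le0.
Qed.
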